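(* For all integers $m,n$ with $2 \leq m \leq n$, $\mathrm{DOM}_t(K_{m,n}) = m+2$.
   Context: An orientation of a (finite simple) graph $G$ is a digraph obtained by directing each edge $uv$ of $G$ in exactly one of the two directions $(u,v)$ or $(v,u)$. The orientation is valid if every vertex has in-degree at least $1$. A set $S\subseteq V(D)$ is a total dominating set of a digraph $D$ if every vertex of $D$ (including those in $S$) has an in-neighbor in $S$; $\gamma_t(D)$ is the minimum cardinality of a total dominating set of $D$. For a graph $G$ in which every component contains a cycle (equivalently, $G$ has a valid orientation), $\mathrm{DOM}_t(G)$ is the maximum of $\gamma_t(D)$ over all valid orientations $D$ of $G$. $K_{m,n}$ is the complete bipartite graph with parts of sizes $m$ and $n$. *)

(* Defs.v *)
From mathcomp Require Import all_boot.

Set Implicit Arguments.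
Unset Strict Implicit.
Unset Printing Implicit Defensive.

Record sgraph := SGraph {
  vertex :> finType;
  edge : rel vertex;
  edge_sym : symmetric edge;
  edge_irr : irreflexive edge }.

(* A digraph on T is its set of arcs: (u, v) \in D is an arc from u to v, so
   that u is an in-neighbor of v. *)
Definition digraph (T : finType) := {set T * T}.

Definition orientation (G : sgraph) (D : digraph G) : bool :=
  [forall u : G, forall v : G,
     (((u, v) \in D) ==> edge u v) &&
     (edge u v ==> ((u, v) \in D) (+) ((v, u) \in D))].

Definition indegree (T : finType) (D : digraph T) (v : T) : nat :=
  #|[set u | (u, v) \in D]|.

Definition valid_orientation (G : sgraph) (D : digraph G) : bool :=
  orientation D && [forall v : G, 1 <= indegree D v].

Definition total_dominating (T : finType) (D : digraph T) (S : {set T}) : bool :=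
  [forall v, exists u in S, (u, v) \in D].

(* The whole vertex set is total dominating exactly when all in-degrees are
   positive; on any other digraph gamma_t takes the junk value #|T|. *)
Definition gamma_t (T : finType) (D : digraph T) : nat :=
  #|[arg min_(S < [set: T] | total_dominating D S) #|S| ]|.

(* 0 by convention when G has no valid orientation. *)
Definition DOM_t (G : sgraph) : nat :=
  \max_(D : digraph G | valid_orientation D) gamma_t D.

Definition Kmn_edge (m n : nat) : rel ('I_m + 'I_n) := fun u v =>
  match u, v with
  | inl _, inr _ | inr _, inl _ => true
  | _, _ => false
  end.

Lemma Kmn_edge_sym (m n : nat) : symmetric (@Kmn_edge m n).
Proof. by case=> ? []. Qed.

Lemma Kmn_edge_irr (m n : nat) : irreflexive (@Kmn_edge m n).
Proof. by case. Qed.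

Definition complete_bipartite (m n : nat) : sgraph :=
  SGraph (@Kmn_edge_sym m n) (@Kmn_edge_irr m n).

(* Main.v *)
Require Import Defs.
From mathcomp Require Import all_boot.

Set Implicit Arguments.
Unset Strict Implicit.
Unset Printing Implicit Defensive.

(** Let [A] and [B] be the parts of the graph, with [m] and [n] vertices. As
    every arc joins the two parts, a total dominating set is a set of vertices
    of [A] dominating [B] together with a set of vertices of [B] dominating [A],
    and the two can be chosen independently.

    Upper bound ([bipartite_domination]): let [T] be an inclusion-minimal subset
    of [A] dominating [B]. By minimality each [a] in [T] has a private vertex in
    [B], dominated by [a] alone within [T], which therefore dominates
    all of [T] but [a]. The set [T] has two distinct elements, since no vertex
    of [A] dominates all of [B] when in-degrees are positive, and
    their two private vertices dominate [T]. One more vertex of [B] for each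
    vertex of [A] outside [T] gives a total dominating set of size at most
    [#|T| + 2 + (m - #|T|) = m + 2].

    Lower bound ([star_orientation_bound]): orient the edges so that each vertex
    of [B] has exactly one in-neighbor and each vertex of [A] is the in-neighbor
    of some vertex of [B], as is possible when [m <= n]. Then all of [A] is
    needed to dominate [B]; and two vertices of [B] are needed to dominate [A],
    since a single one fails to dominate its own in-neighbor. *)

Section TotalDomination.

Variables (T : finType) (D : digraph T).

Lemma total_dominatingP (S : {set T}) :
  reflect (forall v, exists2 u, u \in S & (u, v) \in D) (total_dominating D S).
Proof. by apply: (iffP forallP) => H v; apply/exists_inP/H. Qed.

Lemma total_dominatingS (S S' : {set T}) :
  S \subset S' -> total_dominating D S -> total_dominating D S'.
Proof.
move=> sSS' /total_dominatingP dS; apply/total_dominatingP => v.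
by have [u /(subsetP sSS') uS' uv] := dS v; exists u.
Qed.

Lemma gamma_t_le (S : {set T}) : total_dominating D S -> gamma_t D <= #|S|.
Proof.
move=> dS; have dT := total_dominatingS (subsetT S) dS.
by rewrite /gamma_t; case: arg_minnP => // S0 _; apply.
Qed.

Lemma gamma_t_ge k :
  total_dominating D [set: T] ->
  (forall S : {set T}, total_dominating D S -> k <= #|S|) -> k <= gamma_t D.
Proof. by move=> dT ge_k; rewrite /gamma_t; case: arg_minnP => // S0 /ge_k. Qed.

Lemma total_dominatingT_indegree :
  total_dominating D [set: T] = [forall v, 1 <= indegree D v].
Proof.
apply/total_dominatingP/forallP => [dT v | deg v].
  by have [u _ uv] := dT v; apply/card_gt0P; exists u; rewrite inE.
by have /card_gt0P[u] := deg v; rewrite inE => uv; exists u.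
Qed.

End TotalDomination.

(** An orientation of a complete bipartite graph is a relation [r] between its
    parts: [a] points to [b] when [r a b], and [b] to [a] otherwise. The bound
    comes from minimality of [T]: private vertices of two elements of [T]
    dominate all of [T], so [U] pays one vertex each only for the rest of [A]. *)
Lemma bipartite_domination (A B : finType) (r : A -> B -> bool) :
    0 < #|B| ->
    (forall b, exists a, r a b) -> (forall a, exists b, ~~ r a b) ->
  exists T : {set A}, exists U : {set B},
    [/\ forall b, exists2 a, a \in T & r a b,
        forall a, exists2 b, b \in U & ~~ r a b
      & #|T| + #|U| <= #|A| + 2].
Proof.
move=> /card_gt0P[b0 _] domB domA.
pose dom (T : {set A}) := [forall b, exists a in T, r a b].
have dom_setT : dom setT.
  by apply/forallP => b; have [a ab] := domB b; apply/exists_inP; exists a.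
have [T /minsetP[domT minT] _] := minset_exists dom_setT.
have {}domT b : exists2 a, a \in T & r a b by apply/exists_inP/(forallP domT).
have private a : a \in T -> exists b, forall c, c \in T -> c != a -> ~~ r c b.
  move=> aT; have /forallPn[b /exists_inPn Nb] : ~~ dom (T :\ a).
    apply/negP => /minT/(_ (subsetDl _ _)) TaT.
    by move: aT; rewrite -TaT setD11.
  by exists b => c cT ca; apply: Nb; rewrite in_setD1 ca.
have [a1 a1T _] := domT b0.
have [a2 a2T a12] : exists2 a2, a2 \in T & a2 != a1.
  have [b Na1b] := domA a1; have [a2 a2T a2b] := domT b.
  by exists a2 => //; apply: contraNneq Na1b => <-.
have [b1 b1P] := private a1 a1T; have [b2 b2P] := private a2 a2T.
(* The vertex [b0] is a dummy value: each [a] has an in-neighbor, by [domA]. *)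
pose g a := odflt b0 [pick b | ~~ r a b].
have gP a : ~~ r a (g a).
  rewrite /g; case: pickP => //= none.
  by have [b Nab] := domA a; rewrite none in Nab.
exists T, ([set b1; b2] :|: g @: ~: T); split=> // [a|].
  have [aT | aNT] := boolP (a \in T); last first.
    by exists (g a); rewrite // inE imset_f ?orbT // inE.
  have [-> | ne_a] := eqVneq a a1.
    by exists b2; rewrite ?b2P 1?eq_sym // !inE eqxx orbT.
  by exists b1; rewrite ?b1P // !inE eqxx.
rewrite -(cardsC T) -addnA leq_add2l addnC.
apply: leq_trans (leq_card_setU _ _) (leq_add _ (leq_imset_card _ _)).
by rewrite cards2; case: (_ != _).
Qed.

Section CompleteBipartite.

Variables m n : nat.
Local Notation K := (complete_bipartite m n).

Lemma orientation_arcC (D : digraph K) (a : 'I_m) (b : 'I_n) :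
  orientation D -> ((inr b, inl a) \in D) = ((inl a, inr b) \notin D).
Proof.
move=> /forallP/(_ (inl a))/forallP/(_ (inr b))/andP[_] /=.
by case: (_ \in D); case: (_ \in D).
Qed.

Lemma orientation_loopless (D : digraph K) :
  orientation D ->
  (forall a a' : 'I_m, (inl a, inl a') \notin D) *
  (forall b b' : 'I_n, (inr b, inr b') \notin D).
Proof.
by move=> oD; split=> x y; have /forallP/(_ _)/forallP := oD;
   [move/(_ (inl x) (inl y)) | move/(_ (inr x) (inr y))];
   rewrite /= andbT implybF.
Qed.

Lemma gamma_t_Kmn_le (D : digraph K) :
  0 < n -> valid_orientation D -> gamma_t D <= m + 2.
Proof.
move=> n_gt0 /andP[oD]; rewrite -total_dominatingT_indegree.
move=> /total_dominatingP dT; have [NAA NBB] := orientation_loopless oD.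
have [||| T [U [domT domU cardTU]]] :=
  @bipartite_domination _ _ (fun (a : 'I_m) (b : 'I_n) => (inl a, inr b) \in D).
- by rewrite card_ord.
- move=> b; have [[a|b'] _ ab] := dT (inr b); first by exists a.
  by rewrite (negPf (NBB _ _)) in ab.
- move=> a; have [[a'|b] _ ba] := dT (inl a).
    by rewrite (negPf (NAA _ _)) in ba.
  by exists b; rewrite -orientation_arcC.
rewrite card_ord in cardTU; apply: leq_trans cardTU.
pose S : {set K} := (inl @: T) :|: (inr @: U).
have dS : total_dominating D S.
  apply/total_dominatingP => -[a | b].
    have [b bU ba] := domU a; exists (inr b); rewrite ?orientation_arcC //.
    by rewrite inE orbC imset_f.
  by have [a aT ab] := domT b; exists (inl a); rewrite // inE imset_f.
apply: leq_trans (gamma_t_le dS) (leq_trans (leq_card_setU _ _) _).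
by rewrite leq_add ?leq_imset_card.
Qed.

(** The arcs from ['I_m] to ['I_n] form stars, the fibers of [f]. Since [f b]
    is the unique in-neighbor of [b], it lies in every total dominating set. *)
Definition star_orientation (f : 'I_n -> 'I_m) : digraph K :=
  [set uv : K * K | match uv with
                    | (inl a, inr b) => a == f b
                    | (inr b, inl a) => a != f b
                    | _ => false
                    end].

Lemma star_orientation_valid (f : 'I_n -> 'I_m) :
  1 < m -> (forall a, exists b, f b = a) ->
  valid_orientation (star_orientation f).
Proof.
move=> m_gt1 f_surj; apply/andP; split.
  apply/forallP => u; apply/forallP => v; rewrite !inE.
  by case: u v => [a|b] [a'|b'] //=; rewrite ?implybT //=; case: (_ == _).
apply/forallP => -[a | b]; apply/card_gt0P; last first.
  by exists (inl (f b)); rewrite !inE.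
have /card_gt0P[a' aa'] : 0 < #|[set~ a]| by rewrite cardsC1 card_ord -subn1 subn_gt0.
have [b fb] := f_surj a'; exists (inr b).
by rewrite !inE fb eq_sym; rewrite !inE in aa'.
Qed.

Lemma star_orientation_bound (f : 'I_n -> 'I_m) (S : {set K}) :
  0 < m -> (forall a, exists b, f b = a) ->
  total_dominating (star_orientation f) S -> m + 2 <= #|S|.
Proof.
move=> m_gt0 f_surj /total_dominatingP dS.
have AS (a : 'I_m) : inl a \in S.
  have [b <-] := f_surj a; have [[a'|b'] uS] := dS (inr b); rewrite !inE //.
  by move/eqP <-.
have domA (a : 'I_m) : exists2 b : 'I_n, inr b \in S & a != f b.
  by have [[a'|b] uS] := dS (inl a); rewrite !inE //; exists b.
have [b1 b1S _] := domA (Ordinal m_gt0).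
(* The vertex [b1] cannot dominate [f b1], so another one does. *)
have [b2 b2S fb12] := domA (f b1).
have b12 : b1 != b2 by apply: contraNneq fb12 => ->.
have inlI : injective (@inl 'I_m 'I_n) by move=> ? ? [].
have inrI : injective (@inr 'I_m 'I_n) by move=> ? ? [].
have sub : (inl @: [set: 'I_m]) :|: (inr @: [set b1; b2]) \subset S.
  apply/subUsetP; split; apply/subsetP => _ /imsetP[x xP ->]; first exact: AS.
  by move: xP; rewrite !inE => /orP[] /eqP->.
apply: leq_trans (subset_leq_card sub).
rewrite cardsU disjoint_setI0 ?cards0 ?subn0.
  by rewrite !card_imset // cardsT card_ord cards2 b12.
by apply/pred0P => x /=; apply/negP => /andP[/imsetP[a _ ->] /imsetP[]].
Qed.

End CompleteBipartite.

Theorem theorem3p5 (m n : nat) (hm : 2 <= m) (hmn : m <= n) :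
  DOM_t (complete_bipartite m n) = m + 2.
Proof.
have m_gt0 : 0 < m := ltnW hm.
apply/eqP; rewrite eqn_leq; apply/andP; split.
  by apply/bigmax_leqP => D vD; apply: gamma_t_Kmn_le (leq_trans m_gt0 hmn) vD.
(* The first [m] vertices are matched with ['I_m]; the image of the others is
   immaterial. *)
pose f (b : 'I_n) : 'I_m := insubd (Ordinal m_gt0) (val b).
have f_surj a : exists b, f b = a.
  by exists (widen_ord hmn a); rewrite /f /= valKd.
have vD := star_orientation_valid hm f_surj.
apply: leq_trans (leq_bigmax_cond _ vD).
apply: gamma_t_ge; first by rewrite total_dominatingT_indegree; case/andP: vD.
by move=> S; apply: star_orientation_bound.
Qed.
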